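(* For every $n\in\mathbb{N}$ and every stream $s$: if $\mathit{le}_n\,s$, then $\mu\mathcal{W}\,s$.
   Context: The statement is to be proved constructively (intuitionistic type theory with inductive and coinductive definitions; no excluded middle, no Markov's principle). A color is one of $R$ (red), $B$ (blue). A stream is an element of the coinductive type whose only constructor forms $c\,s$ from a color $c$ and a stream $s$; streams are considered up to bisimilarity (equivalently, functions $\mathbb{N}\to\{R,B\}$ up to pointwise equality). The relation $\mathit{le}_n\,s$ (''$s$ has fewer than $n$ red positions'') is defined coinductively by the rules: $\mathit{le}_{n+1}\,s$ implies $\mathit{le}_{n+1}\,(B\,s)$; $\mathit{le}_n\,s$ implies $\mathit{le}_{n+1}\,(R\,s)$. There is no rule for $\mathit{le}_0$, so $\mathit{le}_0\,s$ is always false. For a stream predicate $X$, the weak until predicate $\mathcal{W}_X$ is defined coinductively by the rules: $\mathcal{W}_X\,s$ implies $\mathcal{W}_X\,(B\,s)$; $X\,s$ implies $\mathcal{W}_X\,(R\,s)$. The operator $X\mapsto\mathcal{W}_X$ is monotone, and $\mu\mathcal{W}$ (''almost always blue'') is its least fixed point, i.e. the predicate defined inductively by the rule: $\mathcal{W}_{\mu\mathcal{W}}\,s$ implies $\mu\mathcal{W}\,s$ (equivalently, Mendler-style: if $X$ is a stream predicate with $\forall s'.\,X\,s'\Rightarrow\mu\mathcal{W}\,s'$ and $\mathcal{W}_X\,s$, then $\mu\mathcal{W}\,s$). *)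

(* Defs.v *)
From Stdlib Require Export Streams.

(* Stdlib's [Stream] is the coinductive type with the single constructor
   [Cons], and [EqSt] is bisimilarity. *)

Inductive color : Set := R | B.

Definition stream : Type := Stream color.

CoInductive le_red : nat -> stream -> Prop :=
| le_red_B : forall n s, le_red (S n) s -> le_red (S n) (Cons B s)
| le_red_R : forall n s, le_red n s -> le_red (S n) (Cons R s).

CoInductive W (X : stream -> Prop) : stream -> Prop :=
| W_B : forall s, W X s -> W X (Cons B s)
| W_R : forall s, X s -> W X (Cons R s).

Lemma W_mono (X Y : stream -> Prop) :
  (forall s, X s -> Y s) -> forall s, W X s -> W Y s.
Proof.
intros HXY; cofix CIH; intros s [s' H | s' H].
- apply W_B; apply CIH; exact H.
- apply W_R; apply HXY; exact H.
Qed.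

(* Mendler style: with the rule [W muW s -> muW s] as constructor, the guard
   condition rejects the corecursive call under a structural recursion needed
   for leastness.  [muW_fold] and [muW_least] below show that this predicate
   is the least one closed under that rule. *)
Inductive muW (s : stream) : Prop :=
| muW_intro : forall X : stream -> Prop,
    (forall s', X s' -> muW s') -> W X s -> muW s.

Lemma muW_fold (s : stream) : W muW s -> muW s.
Proof. apply muW_intro; auto. Qed.

Lemma muW_unfold (s : stream) : muW s -> W muW s.
Proof. intros [X HX H]; exact (W_mono X muW HX s H). Qed.

Lemma muW_least (P : stream -> Prop) :
  (forall s, W P s -> P s) -> forall s, muW s -> P s.
Proof.
intros HP s H; induction H as [s X _ IH H].
apply HP; exact (W_mono X P IH s H).
Qed.

(* The predicates respect bisimilarity, so working with raw streams agrees
   with working up to bisimilarity. *)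

Lemma le_red_EqSt (n : nat) (s t : stream) :
  EqSt s t -> le_red n s -> le_red n t.
Proof.
revert n s t; cofix CIH; intros n s [c t] [Hhd Htl] H.
destruct H as [n s H | n s H]; simpl in Hhd, Htl; subst c.
- apply le_red_B; exact (CIH _ _ _ Htl H).
- apply le_red_R; exact (CIH _ _ _ Htl H).
Qed.

Lemma W_EqSt (X : stream -> Prop) :
  (forall s t, EqSt s t -> X s -> X t) ->
  forall s t, EqSt s t -> W X s -> W X t.
Proof.
intros HX; cofix CIH; intros s [c t] [Hhd Htl] H.
destruct H as [s H | s H]; simpl in Hhd, Htl; subst c.
- apply W_B; exact (CIH _ _ Htl H).
- apply W_R; exact (HX _ _ Htl H).
Qed.

Lemma muW_EqSt (s t : stream) : EqSt s t -> muW s -> muW t.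
Proof.
intros Hst H; revert s H t Hst.
apply (muW_least (fun s => forall t, EqSt s t -> muW t)).
intros s H t Hst.
apply (muW_intro t (fun u => exists v, EqSt v u /\ forall t, EqSt v t -> muW t)).
- intros u [v [Hvu Hv]]; exact (Hv u Hvu).
- apply (W_EqSt _) with (s := s); trivial.
  + intros u u' Huu' [v [Hvu Hv]]; exists v; split; trivial.
    exact (trans_EqSt Hvu Huu').
  + apply (W_mono (fun s => forall t, EqSt s t -> muW t)); trivial.
    intros v Hv; exists v; split; trivial; apply EqSt_reflex.
Qed.

(* Main.v *)
(* If a stream has fewer than [n + 1] reds, the tail after its first red, if
   there is one, has fewer than [n]; so [le_red (S n)] implies [W (le_red n)],
   and induction on [n] concludes. *)

Require Import Defs.

(** Coinduction passes over the blues without deciding whether a red ever comes; induction on the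
    bound [n] handles the reds, each of which lowers the bound by one. *)

Lemma not_le_red_0 (s : stream) : ~ le_red 0 s.
Proof. intros H; inversion H. Qed.

(* [pred n] instead of [S n] in the hypothesis lets [destruct] act on a variable
   index, so the corecursive call stays guarded; at [n = 0] the hypothesis is
   absurd. *)
Lemma le_red_W (n : nat) (s : stream) : le_red n s -> W (le_red (pred n)) s.
Proof.
revert n s; cofix CIH; intros n s [m s' H | m s' H].
- apply W_B; exact (CIH (S m) s' H).
(* [pred (S m)] computes to [m], the bound left after this red. *)
- apply W_R; exact H.
Qed.

Theorem lemma4p2 : forall (n : nat) (s : stream), le_red n s -> muW s.
Proof.
induction n as [| n IH]; intros s H.
- destruct (not_le_red_0 s H).
(* The Mendler rule is used with [X := le_red n], whose inclusion in [muW] is exactly [IH]. *)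
- exact (muW_intro s (le_red n) IH (le_red_W (S n) s H)).
Qed.
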